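(* Let $k\ge 3$ be an integer. Given a (fully) dynamic bounded $k$-sum instance with weight threshold $\mathsf{r}_{\mathsf{max}}$, there is a (fully) dynamic subset sum instance with the same number of items and target threshold $\mathsf{t}_{\mathsf{max}} \le O(k^{k+2}\mathsf{r}_{\mathsf{max}})$ that preserves the query results. More precisely, each insertion (resp. deletion) of a number into (resp. from) a set $\mathsf{A}_i$ corresponds to the insertion (resp. deletion) of one item, and each bounded $k$-sum query corresponds to a subset sum query with a target $t\le \mathsf{t}_{\mathsf{max}}$, such that the answer to each subset sum query equals the answer to the corresponding bounded $k$-sum query.
   Context: (Fully) dynamic bounded $k$-sum: an integer bound $\mathsf{r}_{\mathsf{max}}$ is given in advance; sets $\mathsf{A}_1,\dots,\mathsf{A}_k$ of integers in $[0,\mathsf{r}_{\mathsf{max}}]$ are initially empty; operations insert an integer in $[0,\mathsf{r}_{\mathsf{max}}]$ into some $\mathsf{A}_i$, (in the fully dynamic version) delete a present number from some $\mathsf{A}_i$, or query whether there exist $a_i\in\mathsf{A}_i$ ($1\le i\le k$) with $a_1+\dots+a_{k-1}=a_k$. (Fully) dynamic subset sum: a target threshold $\mathsf{t}_{\mathsf{max}}$ is given in advance; a multiset of items with non-negative integer weights is initially empty; operations insert an item, (in the fully dynamic version) delete a present item, or query, for a given $0\le t\le \mathsf{t}_{\mathsf{max}}$, whether some sub-multiset of the current items has weights summing to exactly $t$.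
   Formalization: The weight threshold r_max is assumed to be at least 1; for r_max = 0 the bound forces t_max = 0, and the only target 0 is always reachable while a k-sum query on empty sets answers no. *)

(* Defs.v *)
From mathcomp Require Import all_boot.

Set Implicit Arguments.
Unset Strict Implicit.
Unset Printing Implicit Defensive.

Inductive op_kind := Insertion | Deletion | Query.

(** * Fully dynamic bounded k-sum

    An instance is a sequence of operations performed from the empty state; it
    is an instance of the (incremental) dynamic problem when it contains no
    [KDelete]. The sets A_1, ..., A_k are [A i] for [i : 'I_k], so A_k is the
    one whose index has value k - 1; [0, r] is the type ['I_r.+1]. *)

Section BoundedKSum.

Variables k r : nat.

Inductive ksum_op :=
  | KInsert of 'I_k & 'I_r.+1
  | KDelete of 'I_k & 'I_r.+1
  | KQuery.

Definition ksum_state := {ffun 'I_k -> {set 'I_r.+1}}.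

Definition ksum_init : ksum_state := [ffun=> set0].

Definition ksum_kind (o : ksum_op) : op_kind :=
  match o with
  | KInsert _ _ => Insertion
  | KDelete _ _ => Deletion
  | KQuery => Query
  end.

Definition ksum_step (A : ksum_state) (o : ksum_op) : ksum_state :=
  match o with
  | KInsert i a => [ffun j => if j == i then a |: A j else A j]
  | KDelete i a => [ffun j => if j == i then A j :\ a else A j]
  | KQuery => A
  end.

Definition ksum_legal (A : ksum_state) (o : ksum_op) : bool :=
  if o is KDelete i a then a \in A i else true.

Definition ksum_answer (A : ksum_state) : bool :=
  [exists a : {ffun 'I_k -> 'I_r.+1},
     [forall i, a i \in A i] &&
     [exists l : 'I_k, (l.+1 == k) && (\sum_(j < k | j != l) a j == a l)]].

Fixpoint ksum_valid (A : ksum_state) (ops : seq ksum_op) : bool :=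
  if ops is o :: ops' then ksum_legal A o && ksum_valid (ksum_step A o) ops'
  else true.

Fixpoint ksum_answers (A : ksum_state) (ops : seq ksum_op) : seq bool :=
  match ops with
  | [::] => [::]
  | KQuery :: ops' => ksum_answer A :: ksum_answers A ops'
  | o :: ops' => ksum_answers (ksum_step A o) ops'
  end.

End BoundedKSum.

Arguments KQuery {k r}.

(** * Fully dynamic subset sum

    The multiset of items is represented by the sequence of their weights;
    [mask m s] runs over the sub-multisets of [s]. *)

Inductive ssum_op :=
  | SInsert of nat
  | SDelete of nat
  | SQuery of nat.

Definition ssum_kind (o : ssum_op) : op_kind :=
  match o with
  | SInsert _ => Insertion
  | SDelete _ => Deletion
  | SQuery _ => Query
  end.

Definition ssum_step (s : seq nat) (o : ssum_op) : seq nat :=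
  match o with
  | SInsert x => x :: s
  | SDelete x => rem x s
  | SQuery _ => s
  end.

Definition ssum_legal (tmax : nat) (s : seq nat) (o : ssum_op) : bool :=
  match o with
  | SInsert _ => true
  | SDelete x => x \in s
  | SQuery t => t <= tmax
  end.

Definition ssum_answer (s : seq nat) (t : nat) : bool :=
  [exists m : (size s).-tuple bool, sumn (mask m s) == t].

Fixpoint ssum_valid (tmax : nat) (s : seq nat) (ops : seq ssum_op) : bool :=
  if ops is o :: ops' then
    ssum_legal tmax s o && ssum_valid tmax (ssum_step s o) ops'
  else true.

Fixpoint ssum_answers (s : seq nat) (ops : seq ssum_op) : seq bool :=
  match ops with
  | [::] => [::]
  | SQuery t :: ops' => ssum_answer s t :: ssum_answers s ops'
  | o :: ops' => ssum_answers (ssum_step s o) ops'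
  end.

(** * Operation-by-operation translation

    The number [a] of [A i] becomes an item of weight [w i a], whatever the
    rest of the instance, and every query becomes the query with target [t].
    (If the translation could depend freely on the history, it could solve
    k-sum itself and ask a subset sum query with a known answer.) The only use
    of the current state is for an insertion of a number that is already
    present: it does not change the set, so its item, which no deletion will
    remove, gets the fixed weight [pad] instead. On instances that insert only
    absent numbers, [pad] is not used. *)

Definition translate_op (k r : nat) (w : 'I_k -> 'I_r.+1 -> nat)
    (pad t : nat) (A : ksum_state k r) (o : ksum_op k r) : ssum_op :=
  match o with
  | KInsert i a => SInsert (if a \in A i then pad else w i a)
  | KDelete i a => SDelete (w i a)
  | KQuery => SQuery t
  end.

Fixpoint translate (k r : nat) (w : 'I_k -> 'I_r.+1 -> nat) (pad t : nat)
    (A : ksum_state k r) (ops : seq (ksum_op k r)) : seq ssum_op :=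
  if ops is o :: ops' then
    translate_op w pad t A o :: translate w pad t (ksum_step A o) ops'
  else [::].

(* Main.v *)
Require Import Defs.
From mathcomp Require Import all_boot.
From mathcomp Require Import zify.

Set Implicit Arguments.
Unset Strict Implicit.
Unset Printing Implicit Defensive.

(** The number [a] of [A_i] (indices from 0) becomes an item of weight
    [low + M * (k ^ i + k ^ k)], where [low] is [a], or [r - a] for the last
    set, and [M = k * r + 1]; the target is
    [r + M * (\sum_i k ^ i + k * k ^ k)].  The summand [k ^ k] prevents more
    than [k] items from being used.  With at most [k] items the low parts do
    not overflow [M], and the digits in base [k] of the high part show,
    starting from the lowest, that each index is used once.  The low parts then
    add up to [r] exactly when the chosen numbers solve the k-sum instance. *)

(** * Sub-multisets with a given sum, and digits in base [k] *)

Lemma ssum_answerP (s : seq nat) (t : nat) :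
  reflect (exists2 u, subseq u s & sumn u = t) (ssum_answer s t).
Proof.
apply: (iffP existsP) => [[m /eqP <-]|[u /subseqP[m sz_m ->] <-]].
  by exists (mask m s) => //; exact: mask_subseq.
by exists (tcast sz_m (in_tuple m)); rewrite val_tcast.
Qed.

Lemma perm_ssum_answer (s1 s2 : seq nat) (t : nat) :
  perm_eq s1 s2 -> ssum_answer s1 t = ssum_answer s2 t.
Proof.
suff imp s s' : perm_eq s s' -> ssum_answer s t -> ssum_answer s' t.
  by move=> e12; apply/idP/idP; apply: imp => //; rewrite perm_sym.
move=> ess' /ssum_answerP[u sub_us <-]; apply/ssum_answerP.
(* The multiplicities in [u] are bounded by those in [s'], so a rearrangement of [u] is a
   subsequence of [s']. *)
have [|u' sub_u's' euu'] := (@count_subseqP _ u s').1.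
  by move=> x; rewrite -(permP ess'); exact: leq_count_subseq.
by exists u'; rewrite // (perm_sumn euu').
Qed.

(** A selection that contains an item heavier than the target already overshoots it. *)
Lemma ssum_answer_pad (n pad t : nat) (s : seq nat) :
  t < pad -> ssum_answer (nseq n pad ++ s) t = ssum_answer s t.
Proof.
move=> lt_t; apply/ssum_answerP/ssum_answerP => [[u]|[u sub_us <-]]; last first.
  by exists u => //; apply: subseq_trans sub_us _; exact: suffix_subseq.
elim: n u => [|n IHn] u /=; first by exists u.
case: u => [|x u] /=; first by move=> _ <-; exists [::]; rewrite ?sub0seq.
case: eqP => [-> _|_]; first by lia.
exact: (IHn (x :: u)).
Qed.

(** Passes from lists of weights to sets of labelled items, so that a selection remembers which set
    each of its numbers comes from. *)
Lemma ssum_answer_enum (T : finType) (X : {set T}) (w : T -> nat) (t : nat) :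
  reflect (exists2 Y : {set T}, Y \subset X & \sum_(p in Y) w p = t)
          (ssum_answer (map w (enum X)) t).
Proof.
apply: (iffP (ssum_answerP _ _)) => [[u /subseqP[m sz_m ->] <-]|[Y sYX <-]].
  have uniq_m : uniq (mask m (enum X)) by rewrite mask_uniq ?enum_uniq.
  exists [set p in mask m (enum X)].
    by apply/subsetP => p; rewrite inE => /mem_mask; rewrite mem_enum.
  rewrite -map_mask sumnE big_map -big_filter.
  rewrite [LHS](perm_big (mask m (enum X))) //=.
  apply: uniq_perm; rewrite ?filter_uniq ?index_enum_uniq // => p.
  by rewrite mem_filter mem_index_enum andbT inE.
exists (map w [seq p <- enum X | p \in Y]).
  exact/map_subseq/filter_subseq.
rewrite sumnE big_map big_filter big_enum_cond /=; apply: eq_bigl => p.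
by case: (boolP (p \in Y)) => [/(subsetP sYX)->|]; rewrite ?andbF.
Qed.

(** Digits are peeled off from the lowest. Modulo [k] the equation says that [c 0] is congruent to
    1, and the bound on the sum leaves only the value 1. The remaining coefficients satisfy the same
    bound, so the induction continues after division by [k]. *)
Lemma digits_eq1 (k n : nat) (c : nat -> nat) (x y : nat) :
  1 < k -> \sum_(i < n) c i <= k ->
  \sum_(i < n) c i * k ^ i + x * k ^ n = \sum_(i < n) k ^ i + y * k ^ n ->
  forall i, i < n -> c i = 1.
Proof.
move=> k_gt1; elim: n c => [//|n IHn] c.
rewrite !big_ord_recl /= !expn0 muln1 /bump /= => le_k.
have shift (f : nat -> nat) :
    \sum_(i < n) f i * k ^ (1 + i) = k * \sum_(i < n) f i * k ^ i.
  by rewrite big_distrr /=; apply: eq_bigr => i _; rewrite add1n expnS mulnCA.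
have shift1 : \sum_(i < n) k ^ (1 + i) = k * \sum_(i < n) k ^ i.
  by rewrite big_distrr /=; apply: eq_bigr => i _; rewrite add1n expnS.
rewrite (shift (fun i => c (1 + i))) shift1 expnS => eq_sum.
have c0 : c 0 = 1.
  have modc : c 0 = 1 %[mod k].
    (* Adding the higher digits, which form a multiple of [k], to each side turns the congruence
       into [eq_sum]. *)
    rewrite -(modnMDl (\sum_(i < n) c (1 + i) * k ^ i + x * k ^ n)).
    rewrite -[RHS](modnMDl (\sum_(i < n) k ^ i + y * k ^ n)).
    by congr (_ %% _); lia.
  (* The bound allows the borderline value [k], but its residue is 0 and not 1. *)
  have : c 0 < k \/ c 0 = k by lia.
  case=> [lt_c|c0k]; first by move: modc; rewrite !modn_small.
  by move: modc; rewrite c0k modnn modn_small.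
case=> [//|i lt_i]; apply: (IHn (fun i => c (1 + i))) => //.
  exact: leq_trans (leq_addl _ _) le_k.
have k_gt0 : 0 < k by lia.
by apply/eqP; rewrite -(eqn_pmul2l k_gt0); apply/eqP; lia.
Qed.

Lemma sum_expn_lt (k n : nat) : 1 < k -> \sum_(i < n) k ^ i < k ^ n.
Proof.
move=> k_gt1; elim: n => [|n IHn]; first by rewrite big_ord0.
rewrite big_ord_recr /= expnS; apply: leq_trans (_ : 2 * k ^ n <= _).
  by rewrite mul2n -addnn ltn_add2r.
by rewrite leq_mul2r k_gt1 orbT.
Qed.

(** * Weights, target, and the selections that reach the target *)

Section Reduction.

Variables k r : nat.
Hypothesis k_ge3 : 3 <= k.

Implicit Types (A : ksum_state k r) (i j l : 'I_k) (p : 'I_k * 'I_r.+1).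
Implicit Types (Y : {set 'I_k * 'I_r.+1}) (a : {ffun 'I_k -> 'I_r.+1}).

Definition low_part i (x : 'I_r.+1) : nat := if i.+1 == k then r - x else x.
Definition modulus : nat := (k * r).+1.
Definition weight i (x : 'I_r.+1) : nat :=
  low_part i x + modulus * (k ^ i + k ^ k).
Definition target : nat := r + modulus * (\sum_(i < k) k ^ i + k * k ^ k).
Definition pad_weight : nat := target.+1.

Lemma target_le : 0 < r -> target <= 4 * (k ^ (k + 2) * r).
Proof.
move=> r_gt0; have lt_S : \sum_(i < k) k ^ i < k ^ k by apply: sum_expn_lt; lia.
rewrite /target /modulus expnD; move: lt_S.
move: (\sum_(i < k) k ^ i) (k ^ k) => S B lt_S.
have leM : (k * r).+1 <= 2 * (k * r) by nia.
(* One factor 2 rounds up the modulus, the other absorbs [S], which is below [B]. The successor in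
   the second factor makes room for the summand [r] of the target. *)
have : (k * r).+1 * (S + k * B).+1 <= 2 * (k * r) * (2 * (k * B)).
  by apply: leq_mul => //; nia.
have -> : 4 * (B * k ^ 2 * r) = 2 * (k * r) * (2 * (k * B)).
  by rewrite expnS expn1; lia.
by apply: leq_trans; rewrite mulnS leq_add2r; nia.
Qed.

Lemma low_part_le i x : low_part i x <= r.
Proof. by rewrite /low_part; case: ifP => _; have := ltn_ord x; lia. Qed.

(** Since [a l] is at most [r], the subtraction [r - a l] is exact, and [r] cancels. *)
Lemma sum_low_part a l : l.+1 = k ->
  (\sum_i low_part i (a i) == r) = (\sum_(j < k | j != l) a j == a l).
Proof.
move=> l_last; rewrite (bigD1 l) //= {1}/low_part l_last eqxx.
rewrite [X in _ + X == _](_ : _ = \sum_(j < k | j != l) a j); last first.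
  apply: eq_bigr => j; rewrite /low_part -val_eqE /=.
  by case: (j.+1 =P k) => //; lia.
have := ltn_ord (a l); move: (\sum_(j < k | j != l) a j) => S; lia.
Qed.

Lemma ksum_answerP A :
  reflect (exists2 a : {ffun 'I_k -> 'I_r.+1},
             forall i, a i \in A i & \sum_i low_part i (a i) = r)
          (ksum_answer A).
Proof.
apply: (iffP existsP) => [[a /andP[/forallP Aa]]|[a Aa sum_a]].
  case/existsP=> l /andP[/eqP l_last].
  by rewrite -sum_low_part // => /eqP; exists a.
have lt_k : k.-1 < k by lia.
have l_last : (Ordinal lt_k).+1 = k by move=> /=; lia.
exists a; apply/andP; split; first exact/forallP.
apply/existsP; exists (Ordinal lt_k); rewrite -sum_low_part //.
by rewrite l_last sum_a !eqxx.
Qed.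

Lemma sum_weight a : \sum_i weight i (a i) =
  \sum_i low_part i (a i) + modulus * (\sum_(i < k) k ^ i + k * k ^ k).
Proof.
by rewrite big_split /= -big_distrr /= big_split /= sum_nat_const card_ord.
Qed.

Definition graph a : {set 'I_k * 'I_r.+1} := [set (i, a i) | i : 'I_k].

Lemma sum_graph a (F : 'I_k -> 'I_r.+1 -> nat) :
  \sum_(p in graph a) F p.1 p.2 = \sum_i F i (a i).
Proof. by rewrite big_imset //= => i j _ _ []. Qed.

(** With [k + 1] items the summands [k ^ k] alone give [modulus * (k + 1) * k ^ k]. This exceeds the
    target, because [r < modulus] and the sum of the lower powers is below [k ^ k]. *)
Lemma card_le_of_sum_weight Y :
  \sum_(p in Y) weight p.1 p.2 = target -> #|Y| <= k.
Proof.
move=> sumY; rewrite leqNgt; apply/negP => lt_kY.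
have lt_S : \sum_(i < k) k ^ i < k ^ k by apply: sum_expn_lt; lia.
have : #|Y| * (modulus * k ^ k) <= target.
  rewrite -sumY -sum_nat_const; apply: leq_sum => p _.
  by rewrite /weight mulnDr; lia.
rewrite /target; move: lt_S; have : r < modulus by rewrite /modulus; nia.
move: (\sum_(i < k) k ^ i) (k ^ k) modulus => S B M lt_M lt_S.
have : k.+1 * (M * B) <= #|Y| * (M * B) by rewrite leq_mul2r lt_kY orbT.
have : M * S.+1 <= M * B by rewrite leq_mul2l lt_S orbT.
lia.
Qed.

Lemma sum_weight_targetP Y : \sum_(p in Y) weight p.1 p.2 = target ->
  exists2 a : {ffun 'I_k -> 'I_r.+1}, Y = graph a & \sum_i low_part i (a i) = r.
Proof.
move=> sumY; have leYk := card_le_of_sum_weight sumY.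
pose c i := #|[set p in Y | p.1 == i]|.
have sum_fst (f : 'I_k -> nat) : \sum_(p in Y) f p.1 = \sum_i c i * f i.
  rewrite (partition_big fst predT) //=; apply: eq_bigr => i _.
  rewrite -sum_nat_const; apply: eq_big => [p|p /andP[_ /eqP->] //].
  by rewrite inE.
have sum_c : \sum_i c i = #|Y|.
  rewrite -sum1_card (sum_fst (fun=> 1)).
  by apply: eq_bigr => i _; rewrite muln1.
have low_lt : \sum_(p in Y) low_part p.1 p.2 < modulus.
  rewrite ltnS; apply: leq_trans (_ : #|Y| * r <= _).
    by rewrite -sum_nat_const; apply: leq_sum => p _; exact: low_part_le.
  by rewrite leq_mul2r leYk orbT.
have r_lt : r < modulus by rewrite /modulus; nia.
have high : \sum_i c i * k ^ i + #|Y| * k ^ k = \sum_(i < k) k ^ i + k * k ^ k.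
  move: sumY; rewrite big_split /= -big_distrr /= big_split /= sum_nat_const.
  rewrite (sum_fst (fun i => k ^ i)) /target ![modulus * _]mulnC.
  (* Both low parts are below [modulus], so the quotients are exactly the high parts. *)
  move=> /(congr1 (divn^~ modulus)).
  by rewrite ![_ + _ * modulus]addnC !divnMDl // !divn_small // !addn0.
have c1 i : c i = 1.
  (* [digits_eq1] takes digits indexed by [nat]; [d] extends [c] by 0 outside ['I_k]. *)
  pose d n := if insub n is Some j then c j else 0.
  have dE j : d j = c j by rewrite /d valK.
  rewrite -dE; apply: (@digits_eq1 k k d #|Y| k) => //; first by lia.
    by rewrite (eq_bigr c) ?sum_c.
  by rewrite -high; congr (_ + _); apply: eq_bigr => j _; rewrite dE.
(* Boolean equality lets [xchoose] assemble these witnesses into a function. *)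
have ex_a i : exists x, [set p in Y | p.1 == i] == [set (i, x)].
  have /eqP/cards1P[[j x] fiber_i] := c1 i; exists x.
  have : (j, x) \in [set p in Y | p.1 == i] by rewrite fiber_i set11.
  by rewrite inE /= => /andP[_ /eqP eq_ji]; rewrite fiber_i eq_ji.
pose a := [ffun i => xchoose (ex_a i)].
have aE i : [set p in Y | p.1 == i] = [set (i, a i)].
  by rewrite ffunE; exact/eqP/(xchooseP (ex_a i)).
have Ya : Y = graph a.
  apply/setP => -[i x]; have /setP/(_ (i, x)) := aE i.
  rewrite !inE eqxx andbT => ->.
  apply/eqP/imsetP => [[->]|[j _ [-> ->]] //].
  by exists i.
(* For a graph the high part equals that of the target, so cancelling it leaves the low parts. *)
exists a => //; move: sumY; rewrite Ya sum_graph sum_weight /target; lia.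
Qed.

(** * Invariant relating the two states along the operations *)

Definition items A : {set 'I_k * 'I_r.+1} := [set p | p.2 \in A p.1].

(** Here [n] counts the insertions of numbers already present; their padding items stay forever.
    Working up to permutation makes the order of insertion irrelevant. *)
Definition represents A (s : seq nat) : Prop := exists n : nat,
  perm_eq s (nseq n pad_weight ++ [seq weight p.1 p.2 | p <- enum (items A)]).

Lemma represents_answer A s :
  represents A s -> ssum_answer s target = ksum_answer A.
Proof.
case=> n /perm_ssum_answer->; rewrite ssum_answer_pad //.
apply/ssum_answer_enum/ksum_answerP => [[Y sYA]|[a Aa sum_a]].
  case/sum_weight_targetP => a Ya sum_a; exists a => // i.
  have : (i, a i) \in items A by rewrite (subsetP sYA) // Ya imset_f.
  by rewrite inE.
exists (graph a); last by rewrite sum_graph sum_weight sum_a.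
by apply/subsetP => p /imsetP[i _ ->]; rewrite inE Aa.
Qed.

Lemma items_insert A i x : items (ksum_step A (KInsert i x)) = (i, x) |: items A.
Proof.
apply/setP => -[j y]; rewrite !inE /= !ffunE xpair_eqE.
by case: eqP => [->|_] //=; rewrite !inE.
Qed.

Lemma items_delete A i x : items (ksum_step A (KDelete i x)) = items A :\ (i, x).
Proof.
apply/setP => -[j y]; rewrite !inE /= !ffunE xpair_eqE.
by case: eqP => [->|_] //=; rewrite !inE.
Qed.

Lemma perm_enum_setU1 (T : finType) (x : T) (X : {set T}) :
  x \notin X -> perm_eq (enum (x |: X)) (x :: enum X).
Proof.
move=> notXx; apply: uniq_perm; rewrite /= ?enum_uniq ?mem_enum ?notXx //.
by move=> y; rewrite !inE !mem_enum !inE.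
Qed.

Lemma represents_insert A s i x : represents A s ->
  represents (ksum_step A (KInsert i x))
             ((if x \in A i then pad_weight else weight i x) :: s).
Proof.
case=> n perm_s; rewrite /represents items_insert.
case: ifPn => [Ax|notAx].
  exists n.+1; rewrite /= perm_cons.
  by rewrite (setUidPr _) ?sub1set ?inE.
exists n; have notXx : (i, x) \notin items A by rewrite inE.
rewrite perm_sym.
have /(perm_map (fun p => weight p.1 p.2)) perm_U := perm_enum_setU1 notXx.
rewrite (permPl (perm_cat (perm_refl _) perm_U)) /=.
by rewrite -cat_rcons -cats1 -catA perm_catCA /= perm_cons perm_sym.
Qed.

Lemma represents_delete A s i x : x \in A i -> represents A s ->
  (weight i x \in s) /\
  represents (ksum_step A (KDelete i x)) (rem (weight i x) s).
Proof.
move=> Ax [n perm_s]; have Xx : (i, x) \in items A by rewrite inE.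
have ws : weight i x \in s.
  rewrite (perm_mem perm_s) mem_cat; apply/orP; right.
  by apply/mapP; exists (i, x); rewrite ?mem_enum.
split=> //; exists n; rewrite items_delete.
(* The multisets are compared after putting the deleted weight back on both sides, whichever
   occurrence [rem] takes out. *)
rewrite -(perm_cons (weight i x)) -(permPl (perm_to_rem ws)).
rewrite (permPl perm_s) perm_sym -cat1s perm_catCA perm_cat2l /=.
have notX : (i, x) \notin items A :\ (i, x) by rewrite !inE eqxx.
have := perm_map (fun p => weight p.1 p.2) (perm_enum_setU1 notX).
by rewrite setD1K // perm_sym.
Qed.

(** Stated for every represented state, since the induction on [ops] changes both states at each
    update. *)
Lemma translate_correct (ops : seq (ksum_op k r)) A s :
  represents A s -> ksum_valid A ops ->
  let sops := translate weight pad_weight target A ops in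
  [/\ map ssum_kind sops = map (@ksum_kind k r) ops,
      ssum_valid target s sops &
      ssum_answers s sops = ksum_answers A ops].
Proof.
elim: ops A s => [//|o ops IHops] A s rep_s /= /andP[legal_o valid_ops].
case: o legal_o valid_ops => [i x|i x|] /= legal_o valid_ops.
- by have [-> -> ->] := IHops _ _ (represents_insert i x rep_s) valid_ops.
- have [-> rep_rem] := represents_delete legal_o rep_s.
  by have [-> -> ->] := IHops _ _ rep_rem valid_ops.
have [-> -> ->] := IHops _ _ rep_s valid_ops.
by rewrite leqnn (represents_answer rep_s).
Qed.

Lemma represents_init : represents (ksum_init k r) [::].
Proof.
exists 0; have -> : items (ksum_init k r) = set0.
  by apply/setP => p; rewrite !inE ffunE inE.
by rewrite enum_set0.
Qed.

End Reduction.

Theorem theorem6 :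
  exists C : nat, forall k : nat, 3 <= k -> forall r : nat, 0 < r ->
  exists (tmax t pad : nat) (w : 'I_k -> 'I_r.+1 -> nat),
    [/\ tmax <= C * (k ^ (k + 2) * r),
        t <= tmax &
        forall ops : seq (ksum_op k r), ksum_valid (ksum_init k r) ops ->
          let sops := translate w pad t (ksum_init k r) ops in
          [/\ map ssum_kind sops = map (@ksum_kind k r) ops,
              ssum_valid tmax [::] sops &
              ssum_answers [::] sops = ksum_answers (ksum_init k r) ops]].
Proof.
exists 4 => k k_ge3 r r_gt0.
exists (target k r), (target k r), (pad_weight k r), (@weight k r).
split=> // [|ops]; first exact: target_le.
exact/translate_correct/represents_init.
Qed.
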